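(* Let $p$ be a prime, $q=p^{f_K}$ with $f_K\ge1$, and let $T\rtimes U$ be a semidirect product where $T=\langle\tau\rangle$ and $U=\langle\upsilon\rangle$ are cyclic groups of orders $e$ and $f$, with $(e,p)=1$, $e\mid q^f-1$, and $\upsilon$ acting on $T$ by $x\mapsto x^q$. Let $T_0$ be any subgroup of $T$, let $\bar T=T/T_0$, and let $\tilde U=C_U(\bar T)$. Every irreducible representation $\rho$ of $T\rtimes U$ in an $\bar{\mathbb{F}}_p$-vector space $V$ such that $\ker(\rho_{|T})=T_0$ is isomorphic to $\mathrm{Ind}_{T\rtimes\tilde U}^{T\rtimes U}(V_\chi)$, where $\chi:T\rtimes\tilde U\to\bar{\mathbb{F}}_p^\times$ is a character of $T\rtimes\tilde U$ such that $\ker(\chi_{|T})=T_0$ and $V_\chi$ is the one-dimensional representation given by $\chi$. Moreover, for two such characters $\chi,\chi'$, $\mathrm{Ind}_{T\rtimes\tilde U}^{T\rtimes U}(V_\chi)\cong\mathrm{Ind}_{T\rtimes\tilde U}^{T\rtimes U}(V_{\chi'})$ if and only if $\chi$ and $\chi'$ are conjugate. The $p$-core of $T\rtimes U$ is contained in the kernel of all irreducible representations of $T\rtimes U$ over $\bar{\mathbb{F}}_p$.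
   Context: $C_U(\bar T)$ is the kernel of the homomorphism $U\to\mathrm{Aut}(\bar T)$ induced by the action of $U$ on $T$. Two characters $\chi,\chi'$ of $T\rtimes\tilde U$ are conjugate if $\chi'$ is obtained from $\chi$ by conjugation by a power of $\upsilon$, i.e. $\chi'(x)=\chi(\upsilon^i x\upsilon^{-i})$ for all $x$ and some integer $i$. The $p$-core of a finite group is the intersection of all its $p$-Sylow subgroups. *)

(* Defs.v *)
From HB Require Import structures.
From mathcomp Require Export all_boot all_order all_algebra all_fingroup.
From mathcomp Require Export all_solvable all_character.

Set Implicit Arguments.
Unset Strict Implicit.
Unset Printing Implicit Defensive.

Import GroupScope GRing.Theory.
Local Open Scope ring_scope.

(* Homomorphisms from H to the multiplicative group of F.  The values outside *)
(* H are irrelevant; those on H are nonzero because chi x * chi x^-1 = 1.     *)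
Record linchar (F : fieldType) (gT : finGroupType) (H : {group gT}) := LinChar {
  linchar_fun :> gT -> F;
  linchar1 : linchar_fun 1%g = 1;
  lincharM : {in H &, {morph linchar_fun : x y / (x * y)%g >-> x * y}}
}.

Section LinRepr.

Variables (F : fieldType) (gT : finGroupType) (H : {group gT}).
Variable chi : linchar F H.

Definition linchar_mx (x : gT) : 'M[F]_1 := (chi x)%:M.

Lemma linchar_mx_repr : mx_repr H linchar_mx.
Proof.
split=> [|x y Hx Hy]; first by rewrite /linchar_mx linchar1.
by rewrite /linchar_mx lincharM // scalar_mxM.
Qed.

Definition linchar_repr : mx_representation F H 1 :=
  MxRepresentation linchar_mx_repr.

End LinRepr.

(* Induction from H to G.  Let (x_i) be representatives of the right cosets   *)
(* H x of H in G.  In W (x)_{FH} FG one has                                   *)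
(*     (w (x) x_i) g = w h (x) x_j    when   x_i g = h x_j with h \in H,      *)
(* so g acts on row vectors, which are the vectors on which library           *)
(* representations act, by the matrix whose (i, j) block is rW (x_i g x_j^-1) *)
(* if x_i g x_j^-1 \in H, and 0 otherwise.                                    *)
Section Induction.

Variables (F : fieldType) (gT : finGroupType) (H G : {group gT}).
Hypothesis sHG : H \subset G.
Variables (n : nat) (rW : mx_representation F H n).

Definition ind_rep (i : 'I_#|G : H|) : gT :=
  repr (enum_val i : {set gT}).

Definition ind_block (x : gT) : 'M[F]_n := if x \in H then rW x else 0.

Definition ind_mx (g : gT) : 'M[F]_(\sum_(i < #|G : H|) n) :=
  \mxblock_(i < #|G : H|, j < #|G : H|)
    ind_block (ind_rep i * g * (ind_rep j)^-1)%g.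

Lemma ind_rep_rcoset i : H :* ind_rep i = enum_val i :> {set gT}.
Proof.
have /rcosetsP[x Gx ix] := enum_valP i.
by rewrite /ind_rep ix; apply/rcoset_eqP; rewrite mem_repr_rcoset.
Qed.

Lemma ind_rep_in i : ind_rep i \in G.
Proof.
have /rcosetsP[x Gx ix] := enum_valP i.
have: ind_rep i \in H :* x by rewrite -ix -ind_rep_rcoset rcoset_refl.
by apply: subsetP; rewrite mul_subG // sub1set.
Qed.

Lemma ind_rep_eq i j : (ind_rep i * (ind_rep j)^-1 \in H)%g = (i == j).
Proof.
rewrite -mem_rcoset; apply/idP/eqP=> [/rcoset_eqP | -> //].
  by rewrite !ind_rep_rcoset => /enum_val_inj.
by rewrite rcoset_refl.
Qed.

Lemma ind_rep_ex x : x \in G -> {k | (x * (ind_rep k)^-1 \in H)%g}.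
Proof.
move=> Gx; have Hx : H :* x \in rcosets H G by apply/rcosetsP; exists x.
exists (enum_rank_in Hx (H :* x)); rewrite -mem_rcoset ind_rep_rcoset.
by rewrite enum_rankK_in // rcoset_refl.
Qed.

Lemma ind_mx_repr : mx_repr G ind_mx.
Proof.
split=> [|g1 g2 Gg1 Gg2].
  rewrite /ind_mx -mxdiagZ /mxdiag; apply: eq_mxblock => i j.
  rewrite mulg1 /ind_block ind_rep_eq; case: eqVneq => [->|neq_ij].
    by rewrite mulgV repr_mx1 conform_mx_id.
  by [].
rewrite /ind_mx mul_mxblock; apply: eq_mxblock => i j.
have [k Hk] := ind_rep_ex (groupM (ind_rep_in i) Gg1).
rewrite (bigD1 k) //= big1 ?addr0 => [|l neq_lk]; last first.
  rewrite /ind_block ifN ?mul0mx //; apply: contra neq_lk => Hl.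
  rewrite -ind_rep_eq; have := groupM (groupVr Hl) Hk.
  by rewrite invMg invgK -mulgA mulKg.
rewrite /ind_block Hk.
have -> : (ind_rep i * (g1 * g2) * (ind_rep j)^-1 =
  (ind_rep i * g1 * (ind_rep k)^-1) * (ind_rep k * g2 * (ind_rep j)^-1))%g.
  by rewrite !mulgA mulgKV.
by rewrite groupMl //; case: ifP => [Hj|_]; [rewrite repr_mxM | rewrite mulmx0].
Qed.

Definition ind_repr : mx_representation F G (\sum_(i < #|G : H|) n) :=
  MxRepresentation ind_mx_repr.

End Induction.

Section TameGroup.

Variables (gT : finGroupType) (G T U T0 : {group gT}).

(* C_U(T / T0): 'Q is the conjugation action on the cosets of T0.             *)
Definition Utilde : {group gT} := 'C_U(T / T0 | 'Q)%G.

Definition TUtilde : {group gT} := (T <*> Utilde)%G.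

Lemma TUtilde_sub : T ><| U = G -> TUtilde \subset G.
Proof.
case/sdprodP=> _ defTU _ _; rewrite join_subG -defTU mulG_subl.
by rewrite (subset_trans (subsetIl _ _)) ?mulG_subr.
Qed.

End TameGroup.

(* upsilon has finite order, so natural exponents give all integer powers.    *)
Definition conj_linchar (F : fieldType) (gT : finGroupType) (ups : gT)
    (H : {group gT}) (chi chi' : linchar F H) : Prop :=
  exists i : nat,
    forall x, x \in H -> chi' x = chi (ups ^+ i * x * ups ^- i)%g.

(* 'O_p(G) is defined by maximal p-subgroups, i.e. the p-Sylow subgroups. *)
Lemma pcore_Syl (p : nat) (gT : finGroupType) (G : {group gT}) :
  'O_p(G) = (\bigcap_(P in 'Syl_p(G)) P)%g.
Proof.
by rewrite /pcore; apply: eq_bigl => P; rewrite max_pgroup_Sylow inE.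
Qed.

(* Main.v *)
(* Put H = T Utilde, so that H is the kernel of the action of G on T / T0 and *)
(* H / T0 is abelian.  If rho is irreducible with kernel T0 on T, then H has  *)
(* an eigenvector v in rho; its character chi has kernel exactly T0 on T,     *)
(* because the vectors fixed by ker (chi|_T), which is normal in G, form a    *)
(* nonzero submodule.  The translates v x_i over the cosets H x_i are         *)
(* eigenvectors of tau with pairwise distinct eigenvalues, since              *)
(* chi (x tau x^-1) determines x modulo H; hence they are independent, and    *)
(* they are a basis on which G acts as in Ind chi.                            *)
(*   The same independence shows that an H-eigenvector with character chi' in *)
(* Ind chi yields Ind chi' ~ Ind chi; on the other hand Ind chi is diagonal   *)
(* on H, so its H-eigenvectors have the conjugates of chi as characters.      *)
Require Import Defs.

Set Implicit Arguments.
Unset Strict Implicit.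
Unset Printing Implicit Defensive.

Import GroupScope GRing.Theory.
Local Open Scope ring_scope.

(** Everything rests on one construction, where [H] is [TUtilde T U T0]. By Frobenius reciprocity,
    an [H]-eigenvector [v] with character [chi] in a representation of [G] gives a homomorphism from
    [Ind chi] to it ([coset_translates_hom]). If [chi] has kernel [T0] on [T], the stabilizer of its
    restriction to [T] is the centralizer [H] of [T / T0] ([linchar_tau_inj]), so [tau] separates
    the translates of [v] and the map is injective ([tame_translates_free]). In an irreducible
    [rho], such a [v] exists because [H / T0] is abelian and the field is algebraically closed
    ([linchar_eigenvector], [irr_linchar_kernel]); the image is then the whole space. Since
    [Ind chi] is diagonal on [H] ([ind_mx_normal]), the characters of its [H]-eigenvectors are
    [G]-conjugates of [chi]; [T] lies in [H], so powers of [ups] suffice to conjugate. For the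
    [p]-core, a normal [p]-subgroup has nonzero fixed vectors in characteristic [p], and they form a
    submodule. *)

Section LinCharTheory.

Variables (F : fieldType) (gT : finGroupType) (H : {group gT}).
Variable chi : linchar F H.

Lemma linchar_mulV x : x \in H -> chi x * chi x^-1%g = 1.
Proof. by move=> Hx; rewrite -lincharM ?groupV // mulgV linchar1. Qed.

Lemma linchar_conj x y :
  x \in H -> y \in H -> chi (x * y * x^-1)%g = chi y.
Proof.
move=> Hx Hy; rewrite !lincharM ?groupM ?groupV //.
by rewrite mulrAC linchar_mulV // mul1r.
Qed.

Lemma linchar_eq1 x y :
  x \in H -> y \in H -> chi x = chi y -> chi (x * y^-1)%g = 1.
Proof.
by move=> Hx Hy eq_xy; rewrite lincharM ?groupV // eq_xy linchar_mulV.
Qed.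

End LinCharTheory.

(** * Common eigenvectors over an algebraically closed field *)

Lemma abelian_eigenvector (F : closedFieldType) (gT : finGroupType)
    (A : {group gT}) n
    (rA : mx_representation F A n) :
    (0 < n)%N -> abelian A ->
  exists2 v : 'rV_n, v != 0 &
    forall x, x \in A -> exists a, v *m rA x = a *: v.
Proof.
move=> n_gt0 cAA.
have nz1: 1%:M != 0 :> 'M[F]_n by rewrite -mxrank_eq0 mxrank1 -lt0n.
have [V simV _] := dec_mxsimple_exists (mxmodule1 rA) nz1.
have rV1: \rank V = 1%N.
  apply: mxsimple_abelian_linear cAA simV => n'.
  exact: group_closure_closed_field.
exists (nz_row V) => [|x Ax]; first exact: nz_row_mxsimple simV.
apply/sub_rVP; have [modV _ _] := simV.
apply: submx_trans (submxMr _ (nz_row_sub V)) _.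
apply: submx_trans (mxmoduleP modV x Ax) _.
rewrite -(geq_leqif (mxrank_leqif_sup (nz_row_sub V))) rV1 rank_rV.
by rewrite (nz_row_mxsimple simV).
Qed.

Lemma linchar_eigenvector (F : closedFieldType) (gT : finGroupType)
    (H : {group gT}) n (rH : mx_representation F H n) :
    (0 < n)%N -> H^`(1)%g \subset rker rH ->
  exists (chi : linchar F H) (v : 'rV_n),
    v != 0 /\ forall x, x \in H -> v *m rH x = chi x *: v.
Proof.
move=> n_gt0 kerH'.
have [v nzv eig_v] :=
  abelian_eigenvector (kquo_repr rH) n_gt0 (sub_der1_abelian kerH').
have [j nzvj]: exists j, v 0 j != 0 by apply/rV0Pn.
(* The eigenvalue is read off at a nonzero coordinate [j] of [v]; the value 1 outside [H] is
   arbitrary. *)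
pose c x := if x \in H then (v *m rH x) 0 j / v 0 j else 1.
have cE x: x \in H -> v *m rH x = c x *: v.
  move=> Hx; have Nx := subsetP (rker_norm rH) x Hx.
  have [a] := eig_v _ (mem_quotient (rker rH) Hx).
  rewrite kquo_repr_coset // => def_vx; rewrite /c Hx def_vx.
  by rewrite mxE mulfK.
have c1: c 1%g = 1 by rewrite /c group1 repr_mx1 mulmx1 divff.
have cM: {in H &, {morph c : x y / (x * y)%g >-> x * y}}.
  move=> x y Hx Hy; apply: (mulIf nzvj).
  have /matrixP/(_ 0 j) := cE _ (groupM Hx Hy).
  by rewrite repr_mxM // mulmxA cE // -scalemxAl cE // scalerA !mxE.
by exists (LinChar c1 cM), v.
Qed.

(** * Maps out of an induced character, and its restriction to a normal subgroup *)

Section InducedCharacter.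

Variables (F : fieldType) (gT : finGroupType) (H G : {group gT}).
Hypothesis sHG : H \subset G.
Variable chi : linchar F H.

Local Notation Ind := (ind_repr sHG (linchar_repr chi)).
Local Notation rep := (@ind_rep gT H G).

(** The Frobenius reciprocity map attached to [v], in the coset basis of the induced module. *)
Definition coset_translates n (rG : mx_representation F G n) (v : 'rV_n) :
    'M_(\sum_(i < #|G : H|) 1, n) :=
  \mxcol_i (v *m rG (rep i)).

Section Translates.

Variables (n : nat) (rG : mx_representation F G n) (v : 'rV[F]_n).
Hypothesis v_eigen : forall x, x \in H -> v *m rG x = chi x *: v.
Local Notation B := (coset_translates rG v).

Lemma coset_translates_hom g : g \in G -> Ind g *m B = B *m rG g.
Proof.
move=> Gg; rewrite /= /ind_mx /coset_translates mul_mxblock_mxrow mxcol_mul.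
apply: eq_mxcol => i.
have [k Hk] := ind_rep_ex H (groupM (ind_rep_in sHG i) Gg).
(* Only the coset [k] of [rep i * g] contributes to row [i]. *)
rewrite (bigD1 k) //= big1 ?addr0 => [|l neq_lk]; last first.
  rewrite /ind_block ifN ?mul0mx //; apply: contra neq_lk => Hl.
  rewrite -(ind_rep_eq l k); have := groupM (groupVr Hl) Hk.
  by rewrite invMg invgK -mulgA mulKg.
have Gk := ind_rep_in sHG k; have Gi := ind_rep_in sHG i.
rewrite /ind_block Hk /= /linchar_mx mul_scalar_mx scalemxAl -v_eigen //.
by rewrite -!mulmxA -!repr_mxM ?groupM ?groupV // mulgKV.
Qed.

(** The translate by [rep i] is an eigenvector of [t] for [chi (rep i * t * (rep i)^-1)], and these
    eigenvalues are pairwise distinct. *)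
Lemma coset_translates_free t :
    v != 0 -> t \in H -> {in G, forall x, x * t * x^-1 \in H}%g ->
    {in G &, forall x y,
       chi (x * t * x^-1)%g = chi (y * t * y^-1)%g -> (x * y^-1 \in H)%g} ->
  row_free B.
Proof.
move=> nzv Ht conjHt inj_t.
pose a i := chi (rep i * t * (rep i)^-1)%g.
have inj_a: injective a.
  by move=> i j /inj_t; rewrite ind_rep_eq => /(_ _ _)/eqP-> //; apply: ind_rep_in.
have Gt: t \in G := subsetP sHG t Ht.
have eigB i : v *m rG (rep i) *m rG t = a i *: (v *m rG (rep i)).
  have Gi := ind_rep_in sHG i.
  rewrite scalemxAl -v_eigen ?conjHt // -!mulmxA -!repr_mxM ?groupM ?groupV //.
  by rewrite mulgKV.
have dxE: mxdirect (\sum_i eigenspace (rG t) (a i)).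
  by apply: mxdirect_sum_eigenspace; apply: in2W.
rewrite -kermx_eq0; apply/rowV0P => w /sub_kermxP.
rewrite -[w]submxrowK /coset_translates mul_mxrow_mxcol => w0.
(* Zero decomposes uniquely along the direct sum of eigenspaces, so each term of the relation [w0]
   vanishes. *)
have [A_ _ _ uniqA] := sub_dsumsmx dxE (sub0mx 1 _).
have w_i i : submxrow w i *m (v *m rG (rep i)) = 0.
  have Pi: i \in [pred i | true] by [].
  rewrite (uniqA (fun i => submxrow w i *m (v *m rG (rep i))) _ _ i Pi) //.
    apply: esym; apply: (uniqA (fun=> 0)) => // [j _|]; first exact: sub0mx.
    by rewrite big1.
  by move=> j _; apply: mulmx_sub; apply/eigenspaceP/eigB.
rewrite -[RHS]mxrow0; apply: eq_mxrow => i; apply/eqP.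
move/eqP: (w_i i); rewrite [submxrow w i]mx11_scalar mul_scalar_mx scalemx_eq0.
case/orP=> [/eqP-> | ]; first by rewrite raddf0.
have /row_free_inj injGi : row_free (rG (rep i)).
  by rewrite row_free_unit repr_mx_unit ?ind_rep_in.
by rewrite -(mul0mx _ (rG (rep i))) (inj_eq (injGi 1%N)) (negPf nzv).
Qed.

End Translates.

Lemma ind_mx_normal (w_ : 'I_#|G : H| -> 'M[F]_1) h : H <| G -> h \in H ->
  (\mxrow_j w_ j) *m Ind h =
     \mxrow_j (chi (rep j * h * (rep j)^-1)%g *: w_ j).
Proof.
move=> nsHG Hh; have [_ nHG] := andP nsHG.
rewrite /= /ind_mx mul_mxrow_mxblock; apply: eq_mxrow => j.
have conjH k : (rep k * h * (rep k)^-1 \in H)%g.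
  have := memJ_norm h (groupVr (subsetP nHG _ (ind_rep_in sHG k))).
  by rewrite conjgE invgK mulgA Hh.
rewrite (bigD1 j) //= big1 ?addr0 => [|k neq_kj].
  by rewrite /ind_block conjH /= /linchar_mx mul_mx_scalar.
rewrite /ind_block ifN ?mulmx0 //; apply: contra neq_kj => Hkj.
rewrite -(ind_rep_eq k j); have := groupM (groupVr (conjH k)) Hkj.
by rewrite invMg invgK -mulgA mulKg.
Qed.

End InducedCharacter.

(** * The centralizer of [T / T0] in [G] *)

Section TUtildeTheory.

Variables (gT : finGroupType) (G T U T0 : {group gT}).
Hypotheses (defG : T ><| U = G) (cycT : cyclic T) (sT0T : T0 \subset T).

Lemma normal_sub_sdprod_cyclic : T0 <| G.
Proof.
have [nsTG _ _ _ _] := sdprod_context defG.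
apply: char_normal_trans nsTG; rewrite sub_cyclic_char //.
Qed.

(** Modular law, as [T] is abelian and so centralizes [T / T0]. Membership in [TUtilde] thus reduces
    to commuting with [tau] modulo [T0]. *)
Lemma TUtildeE : TUtilde T U T0 = 'C_G(T / T0 | 'Q) :> {set gT}.
Proof.
have [nsTG sUG defTU nTU _] := sdprod_context defG.
have nT0G := normal_norm normal_sub_sdprod_cyclic.
have nT0T := subset_trans (normal_sub nsTG) nT0G.
rewrite /= norm_joinEr ?(subset_trans (subsetIl _ _)) //.
rewrite group_modl ?defTU // sub_astabQ nT0T /=.
exact: quotient_abelian (cyclic_abelian cycT).
Qed.

(** [G / T] is abelian, so any subgroup containing [T] is normal. *)
Lemma TUtilde_normal : abelian U -> TUtilde T U T0 <| G.
Proof.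
move=> cUU; have [nsTG _ defTU _ _] := sdprod_context defG.
apply: sub_der1_normal (TUtilde_sub T0 defG).
apply: subset_trans (joing_subl _ _); apply: der1_min (normal_norm nsTG) _.
by rewrite -defTU quotientMidl quotient_abelian.
Qed.

Lemma TUtilde_der1 : abelian U -> (TUtilde T U T0)^`(1)%g \subset T0.
Proof.
move=> cUU; have [nsTG sUG _ _ _] := sdprod_context defG.
have nT0G := normal_norm normal_sub_sdprod_cyclic.
have nT0H := subset_trans (TUtilde_sub T0 defG) nT0G.
have nT0T := subset_trans (normal_sub nsTG) nT0G.
have nT0U := subset_trans sUG nT0G.
have sCU : Utilde T U T0 \subset U := subsetIl _ _.
apply: der1_min => //; rewrite quotientY //; last exact: subset_trans sCU _.
rewrite abelianY !quotient_abelian ?(abelianS sCU) ?(cyclic_abelian cycT) //=.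
have: Utilde T U T0 \subset 'C(T / T0 | 'Q) by apply: subsetIr.
by rewrite sub_astabQ => /andP[].
Qed.

Lemma linchar_tau_inj (F : fieldType) (chi : linchar F (TUtilde T U T0)) tau :
    abelian U -> T = <[tau]> :> {set gT} -> [set x in T | chi x == 1] = T0 ->
  {in G &, forall x y, chi (x * tau * x^-1)%g = chi (y * tau * y^-1)%g ->
     (x * y^-1 \in TUtilde T U T0)%g}.
Proof.
move=> cUU defT defT0 x y Gx Gy.
have [nsTG _ _ _ _] := sdprod_context defG.
have nT0G := normal_norm normal_sub_sdprod_cyclic.
have nHG := normal_norm (TUtilde_normal cUU).
have Gtau: tau \in G by rewrite (subsetP (normal_sub nsTG)) // defT cycle_id.
have Tconj z : z \in G -> (z * tau * z^-1 \in T)%g.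
  move=> Gz; have := memJ_norm tau (groupVr (subsetP (normal_norm nsTG) _ Gz)).
  by rewrite conjgE invgK mulgA => ->; rewrite defT cycle_id.
have sTH: T \subset TUtilde T U T0 := joing_subl _ _.
move/(linchar_eq1 (subsetP sTH _ (Tconj x Gx)) (subsetP sTH _ (Tconj y Gy))).
set c := (_ * _^-1)%g => chi_c.
have {chi_c} T0c: c \in T0 by rewrite -defT0 inE groupM ?groupV ?Tconj //= chi_c.
have [Gy' Gw] : y^-1%g \in G /\ (y^-1 * x)%g \in G by rewrite groupM ?groupV.
(* [x * y^-1] is the conjugate of [y^-1 * x] by [y^-1], and [TUtilde] is normal. *)
suff Hw : (y^-1 * x)%g \in TUtilde T U T0.
  have := memJ_norm (y^-1 * x) (subsetP nHG _ Gy').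
  by rewrite conjgE invgK !mulgA mulgV mul1g Hw.
rewrite TUtildeE inE Gw astabQ mem_morphpre ?(subsetP nT0G) //=.
rewrite defT quotient_cycle ?(subsetP nT0G) // cent_cycle.
have {Gy'} nT0 z : z \in G -> z \in 'N(T0) := subsetP nT0G z.
apply/cent1P/commgP/eqP; rewrite -morphR ?nT0 //=.
(* The commutator is a conjugate of [c], hence lies in the normal subgroup [T0]. *)
apply: coset_id; have <- : (c ^ (x * tau))%g = [~ y^-1 * x, tau]%g.
  rewrite /c conjgE commgEl conjgE !invMg !invgK !mulgA.
  by rewrite mulgKV mulVg mul1g.
by rewrite memJ_norm // nT0 // groupM.
Qed.

End TUtildeTheory.

(** * Classification of the irreducible representations with kernel [T0] on [T] *)

Section TameInduction.

Variables (gT : finGroupType) (G T U T0 : {group gT}) (tau ups : gT).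
Hypotheses (defG : T ><| U = G) (sT0T : T0 \subset T).
Hypotheses (defT : T = <[tau]> :> {set gT}) (defU : U = <[ups]> :> {set gT}).
Local Notation H := (TUtilde T U T0).
Local Notation sHG := (TUtilde_sub T0 defG).

Let cycT : cyclic T. Proof. by rewrite defT cycle_cyclic. Qed.
Let cUU : abelian U. Proof. by rewrite defU cycle_abelian. Qed.
Let nsHG : H <| G. Proof. exact: TUtilde_normal. Qed.
Let sTH : T \subset H. Proof. exact: joing_subl. Qed.

Lemma TUtilde_conj x h : x \in G -> h \in H -> (x * h * x^-1 \in H)%g.
Proof.
move=> Gx Hh; have := memJ_norm h (groupVr (subsetP (normal_norm nsHG) x Gx)).
by rewrite conjgE invgK mulgA Hh.
Qed.

Lemma tame_translates_free (F : fieldType) (chi : linchar F H) n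
    (rG : mx_representation F G n) (v : 'rV_n) :
    [set x in T | chi x == 1] = T0 -> v != 0 ->
    (forall x, x \in H -> v *m rG x = chi x *: v) ->
  row_free (coset_translates H rG v).
Proof.
move=> kerT nzv eig_v.
have Htau: tau \in H by rewrite (subsetP sTH) // defT cycle_id.
apply: (coset_translates_free sHG eig_v nzv Htau) => [x Gx|].
  exact: TUtilde_conj.
exact: linchar_tau_inj kerT.
Qed.

Lemma irr_linchar_kernel (F : fieldType) (chi : linchar F H) n
    (rho : mx_representation F G n) (v : 'rV_n) :
    mx_irreducible rho -> T :&: rker rho = T0 -> v != 0 ->
    (forall x, x \in H -> v *m rho x = chi x *: v) ->
  [set x in T | chi x == 1] = T0.
Proof.
move=> irr_rho kerT nzv eig_v; apply/setP=> x; rewrite inE.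
apply/andP/idP=> [[Tx /eqP chi_x] | T0x]; last first.
  have Tx := subsetP sT0T x T0x.
  split=> //; have: x \in T :&: rker rho by rewrite kerT.
  case/setIP=> _ /rkerP[_ rx1].
  have /eqP := eig_v x (subsetP sTH x Tx).
  rewrite rx1 mulmx1 -subr_eq0 -{1}[v]scale1r -scalerBl scalemx_eq0.
  by rewrite (negPf nzv) orbF subr_eq0 eq_sym.
have sxT : <[x]> \subset T by rewrite cycle_subG.
have nsxG : <[x]> <| G := normal_sub_sdprod_cyclic defG cycT sxT.
(* The fixed space of the normal subgroup generated by [x] is a submodule containing [v], so by
   irreducibility [x] acts trivially. *)
have vfix : (v <= rfix_mx rho <[x]>)%MS.
  apply/rfix_mxP=> _ /cycleP[k ->].
  have Hx := subsetP sTH x Tx; have Gx := subsetP sHG x Hx.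
  elim: k => [|k IHk]; first by rewrite expg0 repr_mx1 mulmx1.
  by rewrite expgS repr_mxM ?groupX // mulmxA eig_v // chi_x scale1r.
have /mx_irrP[_ irr] := irr_rho.
have full : row_full (rfix_mx rho <[x]>).
  apply: irr; first exact: normal_rfix_mx_module.
  by apply: contraNneq nzv => fix0; rewrite -submx0 -fix0.
rewrite -kerT inE Tx; apply/rkerP; split.
  by rewrite -cycle_subG normal_sub.
have := rfix_mxP _ (submx_full 1%:M full).
by move=> /(_ x (cycle_id x)); rewrite mul1mx.
Qed.

Lemma irr_tame_induced (F : closedFieldType) n
    (rho : mx_representation F G n) :
    mx_irreducible rho -> T :&: rker rho = T0 ->
  exists2 chi : linchar F H, [set x in T | chi x == 1] = T0
    & mx_rsim rho (ind_repr sHG (linchar_repr chi)).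
Proof.
move=> irr_rho kerT; have /mx_irrP[n_gt0 irr] := irr_rho.
have [|chi [v [nzv eig_v]]] :=
  @linchar_eigenvector F gT H n (subg_repr rho sHG) n_gt0.
  rewrite rker_subg subsetI der_sub (subset_trans (TUtilde_der1 defG _ _ _)) //.
  by rewrite -kerT subsetIr.
have kerTchi := irr_linchar_kernel irr_rho kerT nzv eig_v.
exists chi => //; apply: mx_rsim_sym.
have freeB := tame_translates_free kerTchi nzv eig_v.
have homB := coset_translates_hom sHG eig_v.
set B := coset_translates _ _ _ in freeB homB.
apply: (MxReprSim _ freeB homB).
(* The image of [Ind chi] is a nonzero submodule, its rank being the index of [H]; irreducibility
   makes it everything, which also equates the dimensions. *)
have fullB : row_full <<B>>%MS.
  apply: irr; last first.
    rewrite -mxrank_eq0 genmxE (eqP freeB) sum_nat_const card_ord muln1.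
    by rewrite -lt0n indexg_gt0.
  rewrite (eqmx_module _ (genmxE B)); apply/mxmoduleP=> g Gg.
  by rewrite -homB // submxMl.
have /eqP := fullB; rewrite genmxE => <-; exact/esym/eqP.
Qed.

Lemma tame_induced_conj (F : fieldType) (chi chi' : linchar F H) :
    [set x in T | chi' x == 1] = T0 ->
  mx_rsim (ind_repr sHG (linchar_repr chi)) (ind_repr sHG (linchar_repr chi'))
    <-> conj_linchar ups chi chi'.
Proof.
move=> kerT'.
(* [e k] is the basis vector of the coset [k]; on it [H] acts by the conjugate of the character by
   [ind_rep k]. *)
pose e k : 'rV[F]_(\sum_(i < #|G : H|) 1) :=
  \mxrow_j (if j == k then 1 else 0 : 'M[F]_1).
have nz_e k : e k != 0.
  apply/eqP=> /(congr1 (fun w => submxrow w k)); rewrite mxrowK eqxx.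
  by move/matrixP/(_ 0 0)/eqP; rewrite !mxE oner_eq0.
have eig_e (psi : linchar F H) k h : h \in H ->
  e k *m ind_repr sHG (linchar_repr psi) h
    = psi (ind_rep k * h * (ind_rep k)^-1)%g *: e k.
- move=> Hh; rewrite ind_mx_normal //.
  rewrite [RHS](_ : _ = \mxrow_j (psi (ind_rep k * h * (ind_rep k)^-1)%g *:
      (if j == k then 1 else 0 : 'M[F]_1))).
    by apply: eq_mxrow => j; case: eqP => [->|] //; rewrite !scaler0.
  by apply/matrixP=> i j; rewrite !mxE.
have Gu i : (ups ^+ i)%g \in G.
  have [_ sUG _ _ _] := sdprod_context defG.
  by rewrite (subsetP sUG) // defU mem_cycle.
split=> [/mx_rsim_sym[B _ freeB homB] | [i def_chi']].
  (* For the trivial coset, [e k] has character [chi'] itself; its image [v] in [Ind chi] has the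
     same character, and any nonzero coordinate of [v] exhibits [chi'] as a conjugate of [chi]. *)
  have [k Hk] := ind_rep_ex H (group1 G).
  have {}Hk : ind_rep k \in H by rewrite -groupV -[_^-1%g]mul1g.
  pose v := e k *m B.
  have nzv : v != 0.
    by rewrite -(mul0mx _ B) (inj_eq (row_free_inj freeB)).
  have eig_v h : h \in H ->
      v *m ind_repr sHG (linchar_repr chi) h = chi' h *: v.
    move=> Hh; rewrite /v -mulmxA -homB ?(subsetP sHG) // mulmxA eig_e //.
    by rewrite linchar_conj // scalemxAl.
  have [j nzj] : exists j, submxrow v j != 0.
    apply/existsP; apply: contraNT nzv => /existsPn v0.
    rewrite -[v]submxrowK -[X in _ == X]mxrow0; apply/eqP/eq_mxrow => j.
    exact/eqP/negPn.
  have Gj := ind_rep_in sHG j.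
  have chi'E h : h \in H -> chi' h = chi (ind_rep j * h * (ind_rep j)^-1)%g.
    move=> Hh; have := eig_v h Hh; rewrite -{1}[v]submxrowK ind_mx_normal //.
    move/(congr1 (fun w => submxrow w j)); rewrite mxrowK.
    have -> : submxrow (chi' h *: v) j = chi' h *: submxrow v j.
      by apply/matrixP=> i l; rewrite !mxE.
    move/eqP; rewrite -subr_eq0 -scalerBl scaler_eq0 (negPf nzj) orbF.
    by rewrite subr_eq0 => /eqP.
  have [_ _ defTU _ _] := sdprod_context defG.
  (* The [T]-part of [ind_rep j] lies in [H], so conjugating by it does not change [chi]. *)
  move: Gj chi'E; rewrite -defTU => /mulsgP[t u Tt].
  rewrite defU => /cycleP[i ->] -> chi'E; exists i => h Hh.
  have Hu : (ups ^+ i * h * ups ^- i \in H)%g := TUtilde_conj (Gu i) Hh.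
  rewrite chi'E // -(linchar_conj chi (subsetP sTH t Tt) Hu).
  by rewrite invMg !mulgA.
(* [ind_rep k] differs from [ups ^+ i] by an element of [H], so [e k] is an eigenvector in [Ind chi]
   with character [chi']; its translates form a square invertible matrix. *)
have [k Hk] := ind_rep_ex H (Gu i).
have eig_k h : h \in H ->
    e k *m ind_repr sHG (linchar_repr chi) h = chi' h *: e k.
  move=> Hh; rewrite eig_e // def_chi' //; congr (_ *: _).
  rewrite -(linchar_conj chi Hk (TUtilde_conj (ind_rep_in sHG k) Hh)).
  by congr (chi _); rewrite invMg invgK !mulgA !mulgKV.
apply: mx_rsim_sym.
have freeB := tame_translates_free kerT' (nz_e k) eig_k.
exact: (MxReprSim _ freeB (coset_translates_hom sHG eig_k)).
Qed.

End TameInduction.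

Theorem proposition4p1
    (p q fK e f : nat) (p_pr : prime p) (fK_ge1 : (1 <= fK)%N)
    (def_q : q = (p ^ fK)%N)
    (* F is an algebraic closure of 'F_p *)
    (F : closedFieldType) (iota : {rmorphism 'F_p -> F})
    (algF : forall x : F, algebraicOver iota x)
    (gT : finGroupType) (G T U : {group gT}) (tau ups : gT)
    (defG : T ><| U = G)
    (defT : T = <[tau]> :> {set gT}) (defU : U = <[ups]> :> {set gT})
    (oT : #|T| = e) (oU : #|U| = f)
    (co_e_p : coprime e p) (e_dvd : (e %| q ^ f - 1)%N)
    (ups_act : forall x, x \in T -> (ups * x * ups^-1 = x ^+ q)%g) :
  (forall (T0 : {group gT}) (sT0T : T0 \subset T),
    let H := TUtilde T U T0 in
    let Ind (chi : linchar F H) :=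
      ind_repr (TUtilde_sub T0 defG) (linchar_repr chi) in
    let kerT (chi : linchar F H) := [set x in T | chi x == 1] in
    (forall (n : nat) (rho : mx_representation F G n),
       mx_irreducible rho -> T :&: rker rho = T0 ->
       exists2 chi : linchar F H, kerT chi = T0 & mx_rsim rho (Ind chi))
    /\
    (forall chi chi' : linchar F H, kerT chi = T0 -> kerT chi' = T0 ->
       (mx_rsim (Ind chi) (Ind chi') <-> conj_linchar ups chi chi')))
  /\
  (forall (n : nat) (rho : mx_representation F G n),
     mx_irreducible rho -> 'O_p(G) \subset rker rho).
Proof.
split=> [T0 sT0T H Ind kerT | n rho].
  split=> [n rho | chi chi' _].
    exact: (irr_tame_induced defG sT0T defT defU).
  exact: (tame_induced_conj defG sT0T defT defU).
(* It remains to see that [F] has characteristic [p], which [iota] transfers from the prime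
   field. *)
apply: pcore_sub_rker_mx_irr_pchar.
by rewrite (fmorph_pchar iota) pchar_Fp.
Qed.
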